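(* Suppose $\Psi:[0,1]\to[0,1]$ is concave and non-decreasing. Then there exists a solution to the problem $\inf_{A\in\mathcal{A}}\mathrm{ProbR}_\Psi(A)$, i.e. there is $A^*\in\mathcal{A}$ with $\mathrm{ProbR}_\Psi(A^* )=\inf_{A\in\mathcal{A}}\mathrm{ProbR}_\Psi(A)$.
   Context: Setting: $\mathcal{X}$ is a set, $\mathcal{A}\subset 2^{\mathcal{X}}$ a $\sigma$-algebra, and $\mu$ a probability measure on $(\mathcal{X}\times\{0,1\},\mathcal{A}\otimes 2^{\{0,1\}})$. For $i\in\{0,1\}$ put $\rho_i(B):=\mu(B\times\{i\})$, and $\rho:=\rho_0+\rho_1$. $\{\mathfrak{m}_x\}_{x\in\mathcal{X}}$ is a family such that $\mathfrak{m}_x$ is a probability measure on $(\mathcal{X},\mathcal{A})$ for $\rho$-almost every $x$, and $x\mapsto\mathfrak{m}_x(B)$ is measurable for every $B\in\mathcal{A}$. For $A\in\mathcal{A}$ (with $A^c=\mathcal{X}\setminus A$): $$\mathrm{ProbR}_\Psi(A):=\rho_0(A)+\rho_1(A^c)+\int_{A^c}\Psi(\mathfrak{m}_x(A))\,d\rho_0(x)+\int_{A}\Psi(\mathfrak{m}_x(A^c))\,d\rho_1(x).$$ *)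

(* Defs.v *)
From HB Require Import structures.
From mathcomp Require Import all_boot all_order all_algebra.
From mathcomp Require Import all_classical all_reals all_analysis.
From mathcomp Require Import measurable_realfun.

Set Implicit Arguments.
Unset Strict Implicit.
Unset Printing Implicit Defensive.

Import Order.TTheory GRing.Theory Num.Theory.
Import numFieldNormedType.Exports.

Local Open Scope classical_set_scope.
Local Open Scope ring_scope.
Local Open Scope ereal_scope.

(* The labels 0 and 1 are [false] and [true]; [bool] carries its discrete
   sigma-algebra. *)
Section label_measure.
Context d (X : measurableType d) (R : realType).
Variables (mu : probability (X * bool)%type R) (i : bool).

Definition label_measure (B : set X) : \bar R := mu (B `*` [set i]).

Let label_measure0 : label_measure set0 = 0.
Proof. by rewrite /label_measure set0X measure0. Qed.

Let label_measure_ge0 B : 0 <= label_measure B.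
Proof. exact: measure_ge0. Qed.

Let label_measure_sigma_additive : semi_sigma_additive label_measure.
Proof.
move=> F mF tF mUF; rewrite /label_measure.
have -> : (\bigcup_n F n) `*` [set i] = \bigcup_n (F n `*` [set i]).
  apply/seteqP; split => [[x b] [[n _ Fx] /= bi]|[x b] [n _ [/= Fx bi]]].
  - by exists n.
  - by split => //; exists n.
have mFi n : measurable (F n `*` [set i]) by exact: measurableX.
apply: measure_semi_sigma_additive => //.
- apply/trivIsetP => j k _ _ jk.
  rewrite -setXI; move/trivIsetP : tF => /(_ _ _ Logic.I Logic.I jk) ->.
  by rewrite set0X.
- exact: bigcup_measurable.
Qed.

HB.instance Definition _ := isMeasure.Build _ _ _ label_measure
  label_measure0 label_measure_ge0 label_measure_sigma_additive.

End label_measure.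

Section prob_risk.
Context d (X : measurableType d) (R : realType).

(* Only the values on measurable sets count: a library measure is also defined,
   and nonnegative, on nonmeasurable sets. *)
Definition is_probability (nu : set X -> \bar R) : Prop :=
  exists P : probability X R, forall B, measurable B -> nu B = P B.

(* [fine] is harmless: [m x A] lies in [0, 1] for almost every [x]. *)
Definition ProbR (mu : probability (X * bool)%type R)
    (m : X -> set X -> \bar R) (Psi : R -> R) (A : set X) : \bar R :=
  label_measure mu false A + label_measure mu true (~` A)
  + \int[label_measure mu false]_(x in ~` A) (Psi (fine (m x A)))%:E
  + \int[label_measure mu true]_(x in A) (Psi (fine (m x (~` A))))%:E.

End prob_risk.

(* Main.v *)
(* The risk splits as ProbR(A) = G0(A) + G1(A^c), where Gi(A) is the
   rho_i-integral of r_A, with r_A(x) = 1 for x in A and r_A(x) = Psi(m_x(A))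
   otherwise.  As Psi is concave and nondecreasing with values in [0, 1],
   each Gi is monotone, submodular and continuous along increasing sequences
   (Psi may jump, but only upwards at 0).  By submodularity, if the A_n are
   2^-n-optimal, then A_k `|` ... `|` A_(k+N) is 2^(1-k)-optimal for every N,
   and continuity passes this bound to the union of all A_n with n >= k; the
   limsup of the A_n is then optimal.  No compactness is needed, nor any
   absolute continuity of m_x with respect to rho. *)
Require Import Defs.
From HB Require Import structures.
From mathcomp Require Import all_boot all_order all_algebra.
From mathcomp Require Import all_classical all_reals all_analysis.
From mathcomp Require Import measurable_realfun.
From mathcomp Require Import lra.

Set Implicit Arguments.
Unset Strict Implicit.
Unset Printing Implicit Defensive.

Import Order.TTheory GRing.Theory Num.Theory.
Import numFieldNormedType.Exports.

Local Open Scope classical_set_scope.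
Local Open Scope ring_scope.

(** * Minimization of a sum of two submodular set functions *)

Section submodular_minimization.
Context d (X : measurableType d) (R : realType).
Implicit Types (G : set X -> R) (A B : set X).

(** Continuity is asked along increasing sequences only: along decreasing ones it can fail for the
    risk integrals when [Psi] jumps at 0. *)
Record submodular_capacity G : Prop := SubmodularCapacity {
  capacity_ge0 : forall A, measurable A -> 0 <= G A ;
  capacity_le : forall A B, measurable A -> measurable B ->
    A `<=` B -> G A <= G B ;
  capacity_submodular : forall A B, measurable A -> measurable B ->
    G (A `|` B) + G (A `&` B) <= G A + G B ;
  capacity_cvg : forall U : (set X)^nat, (forall n, measurable (U n)) ->
    nondecreasing_seq U -> G (U n) @[n --> \oo] --> G (\bigcup_n U n) }.

(* Increasing sets make [G0] converge and [G1] of the complement decrease;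
   decreasing sets are covered by exchanging [G0] and [G1]. *)
Lemma bigcup_sum_le G0 G1 (U : (set X)^nat) (c : R^nat) (l : R) :
    submodular_capacity G0 -> submodular_capacity G1 ->
    (forall n, measurable (U n)) -> nondecreasing_seq U ->
    (forall n, G0 (U n) + G1 (~` U n) <= c n) -> c n @[n --> \oo] --> l ->
  G0 (\bigcup_n U n) + G1 (~` \bigcup_n U n) <= l.
Proof.
move=> G0P G1P mU ndU Uc cl; set V := \bigcup_n U n.
have mV : measurable V by exact: bigcup_measurable.
have cvgU : G0 (U n) + G1 (~` V) @[n --> \oo] --> G0 V + G1 (~` V).
  by apply: cvgD; [exact: (capacity_cvg G0P)|exact: cvg_cst].
apply: (ler_cvg_to cvgU cl); apply: nearW => n; apply: le_trans (Uc n).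
rewrite lerD2l; apply: (capacity_le G1P); [exact: measurableC..|].
by apply: subsetC; exact: bigcup_sup.
Qed.

Lemma submodular_capacity_minimizer G0 G1 :
    submodular_capacity G0 -> submodular_capacity G1 ->
  exists2 A, measurable A &
    forall B, measurable B -> G0 A + G1 (~` A) <= G0 B + G1 (~` B).
Proof.
move=> G0P G1P; pose F A := G0 A + G1 (~` A).
pose I := inf [set F B | B in measurable].
have Flb : has_lbound [set F B | B in measurable].
  exists 0 => _ [B mB <-]; apply: addr_ge0; first exact: (capacity_ge0 G0P).
  by apply: (capacity_ge0 G1P); exact: measurableC.
have I_le B : measurable B -> I <= F B by move=> mB; apply: ge_inf => //; exists B.
have /choice[A AP] : forall n, exists B, measurable B /\ F B <= I + 2^-1 ^+ n.
  move=> n.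
  have [||_ [B mB <-] /ltW FB] := @inf_adherent _ [set F B | B in measurable]
    (2^-1 ^+ n).
  - by rewrite exprn_gt0// invr_gt0.
  - by split=> //; exists (F setT), setT.
  - by exists B.
have mA n : measurable (A n) by case: (AP n).
pose U k N := \bigcup_(i < N.+1) A (k + i)%N.
have mU k N : measurable (U k N) by exact: bigcup_measurable.
have US k N : U k N.+1 = U k N `|` A (k + N.+1)%N.
  by rewrite /U !bigcup_mkord big_ord_recr.
(* The excess over [I] is the sum of [2^-1 ^+ (k + i)] for [i] from 0 to [N], the total error of the
   [N.+1] sets united in [U k N]. *)
have FU k N : F (U k N) <= I + 2 * 2^-1 ^+ k - 2^-1 ^+ (k + N).
  elim: N => [|N IH].
    rewrite /U bigcup_mkord big_ord1 addn0.
    by apply: le_trans (AP k).2 _; lra.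
  rewrite US; set C := U k N in IH *; set D := A _.
  have mC : measurable C by exact: mU.
  have mD : measurable D by exact: mA.
  (* The two submodularity inequalities add up to one for [F]. As [F] is at least [I] at the
     intersection, the excess at the union is at most the sum of the excesses at [C] and [D]. *)
  have := capacity_submodular G0P mC mD.
  have := capacity_submodular G1P (measurableC mC) (measurableC mD).
  rewrite -setCU -setCI.
  have := I_le _ (measurableI _ _ mC mD).
  have := (AP (k + N.+1)%N).2; move: IH.
  rewrite -/D addnS exprS /F; lra.
pose B k := \bigcup_n A (k + n)%N.
have BE k : B k = \bigcup_N U k N.
  apply/seteqP; split=> x [n /= nn Ax]; first by exists n => //; exists n => //=.
  by case: Ax => i _ Ai; exists i.
have mB k : measurable (B k) by exact: bigcup_measurable.
have half : `|2^-1 : R| < 1 by rewrite ger0_norm; lra.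
have FB k : F (B k) <= I + 2 * 2^-1 ^+ k.
  have c_cvg : I + 2 * 2^-1 ^+ k - 2^-1 ^+ (k + N) @[N --> \oo] -->
      I + 2 * 2^-1 ^+ k.
    rewrite -[X in _ --> X]subr0; apply: cvgB; first exact: cvg_cst.
    under eq_fun do rewrite addnC.
    by have := cvg_expr half; rewrite -(cvg_shiftn k).
  rewrite BE; apply: (bigcup_sum_le G0P G1P (mU k) _ (FU k) c_cvg).
  by apply/nondecreasing_seqP => N; rewrite US; apply/subsetPset/subsetUl.
have c_cvg : I + 2 * 2^-1 ^+ k @[k --> \oo] --> I.
  rewrite -[X in _ --> X]addr0.
  by apply: cvgD; [exact: cvg_cst|exact: cvg_geometric].
exists (\bigcap_k B k); first exact: bigcap_measurable.
move=> C mC; apply: le_trans (I_le _ mC).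
(* The [B k] decrease, so their intersection is reached through the increasing union of their
   complements, with [G0] and [G1] exchanged. *)
rewrite -[\bigcap_k B k]setCK setC_bigcap setCK addrC.
apply: (bigcup_sum_le G1P G0P (U := fun k => ~` B k) _ _ _ c_cvg).
- by move=> n; exact: measurableC.
- apply/nondecreasing_seqP => k; apply/subsetPset/subsetC => x [i _ Ai].
  by exists i.+1 => //; rewrite addnS -addSn.
- by move=> n; rewrite setCK addrC; exact: FB.
Qed.

End submodular_minimization.

(** * Comparison of integrals away from a null set *)

Section integral_null_set.
Local Open Scope ereal_scope.
Context d (T : measurableType d) (R : realType).
Variable mu : {measure set T -> \bar R}.
Import HBNNSimple.
Implicit Types (f g : T -> \bar R) (D N : set T).

(* No measurability of [f] and [g] is required: [Psi] is arbitrary outside of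
   [[0, 1]], so the integrands of the risk may fail to be measurable on the null
   set where [m x] is not a probability measure. *)
Lemma ge0_le_integral_null_set N f g : measurable N -> mu N = 0 ->
    (forall x, 0 <= f x) -> (forall x, 0 <= g x) ->
    (forall x, ~ N x -> f x <= g x) ->
  \int[mu]_x f x <= \int[mu]_x g x.
Proof.
move=> mN N0 f0 g0 fg; rewrite !ge0_integralTE//.
apply: ge_ereal_sup => _ [h /= hf <-].
have mCN : measurable (~` N) by exact: measurableC.
(* Cutting [h] to zero on [N] gives a simple function below [g] everywhere, since [g] is nonnegative
   on [N], and keeps the integral. *)
apply: ereal_sup_ubound; exists (proj_nnsfun h mCN).
  move=> x /=; rewrite mindicE; case: (asboolP ((~` N) x)) => [Nx|Nx].
    by rewrite mem_set// mulr1; apply: le_trans (hf x) (fg x Nx).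
  by rewrite memNset// mulr0; exact: g0.
rewrite -!integralT_nnsfun/=.
rewrite [RHS](ge0_negligible_integral mN measurableT _ _ N0)//; last 2 first.
- by apply/measurable_EFinP; exact: measurable_funP.
- by move=> x _; rewrite lee_fin.
rewrite setTD [RHS]integral_mkcond; apply: eq_integral => x _.
rewrite mindicE patchE; case: ifP => _; by rewrite ?mulr1 ?mulr0.
Qed.

(** The inequality is applied in both directions to the positive and the negative parts, extended by
    0 outside [D]. *)
Lemma eq_integral_null_set N D f g : measurable N -> mu N = 0 ->
    (forall x, D x -> ~ N x -> f x = g x) ->
  \int[mu]_(x in D) f x = \int[mu]_(x in D) g x.
Proof.
move=> mN N0 fg; rewrite integralE [RHS]integralE.
congr (_ - _); rewrite integral_mkcond [RHS]integral_mkcond; apply/eqP;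
  rewrite eq_le; apply/andP; split;
  apply: (ge0_le_integral_null_set mN N0) => x; rewrite ?erestrict_ge0//;
  move=> Nx; rewrite !patchE; case: ifPn => // /set_mem Dx;
  by rewrite ?funeposE ?funenegE (fg x Dx Nx).
Qed.

End integral_null_set.

(** * Concave nondecreasing functions on [0, 1] *)

Section concave_nondecreasing.
Variables (R : realType) (Psi : R -> R).
Hypothesis Psi01 : forall t, t \in `[0, 1] -> Psi t \in `[0, 1].
Hypothesis Psi_concave : convex_function (`[0, 1]%classic : set R)
  (fun t => - Psi t).
Hypothesis Psi_nd : {in `[0, 1] &, {homo Psi : s t / s <= t}}.

Lemma concave_le (p a b : R) : 0 <= p <= 1 -> a \in `[0, 1] -> b \in `[0, 1] ->
  p * Psi a + (1 - p) * Psi b <= Psi (p * a + (1 - p) * b).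
Proof.
move=> /andP[p0 p1] a01 b01.
have : - Psi (p * a + (1 - p) * b) <= p * - Psi a + (1 - p) * - Psi b :=
  Psi_concave (Itv01 p0 p1) (mem_set a01) (mem_set b01).
lra.
Qed.

(** Both [a] and [b] are convex combinations of [u] and [w], with exchanged weights; adding the two
    concavity inequalities gives the claim. It serves for [u] and [w] the masses of an intersection
    and of a union. *)
Lemma concave_mid_le (u a b w : R) : u \in `[0, 1] -> w \in `[0, 1] ->
  u <= a <= w -> u + w = a + b -> Psi u + Psi w <= Psi a + Psi b.
Proof.
move=> u01 w01 /andP[ua aw] uwab.
have [uw|uw] := eqVneq u w.
  have au : a = u by lra.
  have bu : b = u by lra.
  by rewrite -uw au bu.
have w_u : 0 < w - u by rewrite subr_gt0 lt_neqAle uw (le_trans ua aw).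
pose p := (a - u) / (w - u).
have p0 : 0 <= p by apply: divr_ge0; [rewrite subr_ge0|exact: ltW].
have p1 : p <= 1 by rewrite ler_pdivrMr// mul1r; lra.
have pE : p * (w - u) = a - u by rewrite divfK// gt_eqF.
have ha := @concave_le p w u; have hb := @concave_le p u w.
rewrite p0 p1 in ha hb; have {ha}/= := ha isT w01 u01.
have {hb}/= := hb isT u01 w01.
have -> : p * u + (1 - p) * w = b by lra.
have -> : p * w + (1 - p) * u = a by lra.
lra.
Qed.

(** A jump at 0 is invisible from below: if [s] is 0, so is every [t n]. Otherwise [Psi (t n)] is
    squeezed between [Psi s] and the line from the origin to the graph point at [s]. *)
Lemma concave_cvg (t : R^nat) (s : R) : (forall n, t n \in `[0, 1]) ->
    s \in `[0, 1] -> (forall n, t n <= s) -> t n @[n --> \oo] --> s ->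
  Psi (t n) @[n --> \oo] --> Psi s.
Proof.
move=> t01 s01 ts tcvg.
have [s0|s0] := eqVneq s 0.
  apply: cvg_near_cst; apply: nearW => n; congr Psi; apply/eqP.
  by rewrite eq_le ts s0; have /[!in_itv]/= /andP[] := t01 n.
have s_gt0 : 0 < s by move: s01; rewrite in_itv/= => /andP[? _]; rewrite lt_def s0.
(* concavity between 0 and s, with Psi 0 >= 0 *)
have lower n : t n / s * Psi s <= Psi (t n).
  have /[!in_itv]/= /andP[tn0 tn1] := t01 n.
  have O01 : (0 : R) \in `[0, 1] by rewrite in_itv/= lexx ler01.
  have p01 : 0 <= t n / s <= 1.
    by rewrite divr_ge0 ?(ltW s_gt0)//= ler_pdivrMr// mul1r.
  have := concave_le p01 s01 O01; rewrite mulr0 addr0 divfK//; apply: le_trans.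
  rewrite lerDl mulr_ge0 ?subr_ge0//; first by case/andP: p01.
  by have := Psi01 O01; rewrite in_itv => /andP[].
apply: (@squeeze_cvgr _ _ _ _ (fun n => t n / s * Psi s) (fun=> Psi s)).
- by apply: nearW => n; rewrite lower Psi_nd.
- rewrite -[X in _ --> X]mul1r -[X in X * _](divff s0).
  by do 2 (apply: cvgM; last exact: cvg_cst).
- exact: cvg_cst.
Qed.

End concave_nondecreasing.

(** * The pointwise risk and its integral, on a set [E] where each [m x] is a probability measure *)

Section risk_capacity.
Context d (X : measurableType d) (R : realType).
Variables (m : X -> set X -> \bar R) (Psi : R -> R) (E : set X).
Hypothesis mE : measurable E.
Hypothesis m_prob : forall x, E x -> is_probability (m x).
Hypothesis m_meas : forall B, measurable B -> measurable_fun [set: X] (m ^~ B).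
Hypothesis Psi01 : forall t, t \in `[0, 1] -> Psi t \in `[0, 1].
Hypothesis Psi_concave : convex_function (`[0, 1]%classic : set R)
  (fun t => - Psi t).
Hypothesis Psi_nd : {in `[0, 1] &, {homo Psi : s t / s <= t}}.
Implicit Types A B : set X.

Definition risk A x : R := if x \in A then 1 else Psi (fine (m x A)).

Lemma fine_kernel01 x A : E x -> measurable A -> fine (m x A) \in `[0, 1].
Proof.
move=> Ex mA; have [P mP] := m_prob Ex; rewrite mP// in_itv/=.
rewrite fine_ge0//= -lee_fin fineK ?fin_num_measure//.
exact: probability_le1.
Qed.

Lemma le_fine_kernel x A B : E x -> measurable A -> measurable B ->
  A `<=` B -> fine (m x A) <= fine (m x B).
Proof.
move=> Ex mA mB AB; have [P mP] := m_prob Ex; rewrite !mP//.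
by apply: fine_le; rewrite ?fin_num_measure// le_measure ?inE.
Qed.

Lemma fine_kernelUI x A B : E x -> measurable A -> measurable B ->
  fine (m x (A `&` B)) + fine (m x (A `|` B)) = fine (m x A) + fine (m x B).
Proof.
move=> Ex mA mB; have [P mP] := m_prob Ex.
have mAB := measurableI _ _ mA mB; have mU := measurableU _ _ mA mB.
rewrite !mP// -!fineD ?fin_num_measure//; congr fine.
have -> : A `|` B = (A `\` B) `|` B by rewrite setDE setUIl setvU setIT.
rewrite measureU//; [|exact: measurableD|by rewrite setDE -setIA setICl setI0].
by rewrite addeA [X in (X + _)%E]addeC -measureDI.
Qed.

Lemma fine_kernel_cvg x (U : (set X)^nat) : E x ->
    (forall n, measurable (U n)) -> nondecreasing_seq U ->
  fine (m x (U n)) @[n --> \oo] --> fine (m x (\bigcup_n U n)).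
Proof.
move=> Ex mU ndU; have [P mP] := m_prob Ex.
have mV : measurable (\bigcup_n U n) by exact: bigcup_measurable.
under eq_fun do rewrite mP//; rewrite mP//.
apply: fine_cvg; rewrite fineK ?fin_num_measure//.
exact: nondecreasing_cvg_mu.
Qed.

Lemma risk01 A x : E x -> measurable A -> 0 <= risk A x <= 1.
Proof.
move=> Ex mA; rewrite /risk; case: ifP => _; first by rewrite ler01 lexx.
by have := Psi01 (fine_kernel01 Ex mA); rewrite in_itv.
Qed.

Lemma measurable_risk A : measurable A -> measurable_fun E (risk A).
Proof.
move=> mA; apply: measurable_fun_if => //.
- apply: (measurable_fun_bool true).
  rewrite (_ : _ @^-1` _ = A); first exact: measurableI.
  by apply/seteqP; split=> x /= => [/set_mem|/mem_set].
- apply: (@measurable_funS _ _ _ _ E) => //.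
  (* [Psi] is monotone on [0, 1] only. After truncation to [0, 1] it is nondecreasing on the whole
     line, hence measurable, and unchanged at the values taken on [E]. *)
  pose clip (t : R) := Num.max 0 (Num.min 1 t).
  have clip_id x : E x -> clip (fine (m x A)) = fine (m x A).
    move=> Ex; have /[!in_itv]/= /andP[t0 t1] := fine_kernel01 Ex mA.
    by rewrite /clip min_r// max_r.
  apply: (eq_measurable_fun (fun x => (Psi \o clip) (fine (m x A)))).
    by move=> x /set_mem Ex /=; rewrite clip_id.
  apply: (@measurableT_comp _ _ _ _ _ _ (Psi \o clip)).
    apply: nondecreasing_measurable => // s t st /=.
    have clip01 u : clip u \in `[0, 1].
      by rewrite in_itv/= /clip le_max lexx/= ge_max ler01 ge_min lexx.
    apply: Psi_nd => //; rewrite /clip.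
    rewrite ge_max le_max lexx/= le_max; apply/orP; right.
    by rewrite le_min ge_min lexx/= ge_min st orbT.
  apply: measurableT_comp; first exact: fine_measurable.
  by apply: measurable_funTS; exact: m_meas.
Qed.

Lemma le_risk A B x : E x -> measurable A -> measurable B -> A `<=` B ->
  risk A x <= risk B x.
Proof.
move=> Ex mA mB AB; have /andP[_ A1] := risk01 Ex mA.
rewrite /risk in A1 *; case: ifPn A1 => [/set_mem/AB/mem_set->//|xA A1].
case: ifPn => // xB; apply: Psi_nd; rewrite ?fine_kernel01//.
exact: le_fine_kernel.
Qed.

(** If [x] lies in [A] or in [B], that set and the union both have risk 1, and monotonicity compares
    the other two terms. Outside both sets, additivity of [m x] reduces the claim to
    [concave_mid_le]. *)
Lemma risk_submodular A B x : E x -> measurable A -> measurable B ->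
  risk (A `|` B) x + risk (A `&` B) x <= risk A x + risk B x.
Proof.
move=> Ex mA mB.
have mI := measurableI _ _ mA mB; have mU := measurableU _ _ mA mB.
have IA := le_risk Ex mI mA (@subIsetl _ _ _).
have IB := le_risk Ex mI mB (@subIsetr _ _ _).
rewrite {1 3}/risk in_setU; case: (boolP (x \in A)) => xA /=.
  by rewrite lerD2l.
rewrite {2}/risk; case: (boolP (x \in B)) => xB /=.
  by rewrite addrC -/(risk A x) lerD2r /risk (negbTE xA) in IA *.
rewrite /risk in_setI (negbTE xA) (negbTE xB)/= addrC.
apply: concave_mid_le; rewrite ?fine_kernel01 ?fine_kernelUI//.
by rewrite !le_fine_kernel.
Qed.

(** A point of the union lies in all [U n] from some index on, where the risk is constantly 1. At
    any other point, [Psi] is evaluated along masses that approach their limit from below. *)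
Lemma risk_cvg (U : (set X)^nat) x : E x -> (forall n, measurable (U n)) ->
  nondecreasing_seq U -> risk (U n) x @[n --> \oo] --> risk (\bigcup_n U n) x.
Proof.
move=> Ex mU ndU; rewrite /risk; case: ifPn => [/set_mem[N _ UNx]|xU].
  apply: cvg_near_cst; exists N => // n /= Nn.
  by rewrite mem_set//; move/subsetPset : (ndU _ _ Nn); exact.
have xUn n : (x \in U n) = false.
  by apply: contraNF xU => /set_mem Ux; apply/mem_set; exists n.
under eq_fun do rewrite xUn.
have mV : measurable (\bigcup_n U n) by exact: bigcup_measurable.
apply: concave_cvg => //; try by move=> *; exact: fine_kernel01.
- by move=> n; apply: le_fine_kernel => //; exact: bigcup_sup.
- exact: fine_kernel_cvg.
Qed.

Variable nu : {measure set X -> \bar R}.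
Hypothesis nu_fin : (nu setT < +oo)%E.

Lemma integrable_risk A : measurable A -> nu.-integrable E (EFin \o risk A).
Proof.
move=> mA; apply: measurable_bounded_integrable => //.
- by apply: le_lt_trans nu_fin; rewrite le_measure ?inE.
- exact: measurable_risk.
- exists 1; split=> // M M1 x Ex /=; have /andP[r0 r1] := risk01 Ex mA.
  by rewrite ger0_norm// (le_trans r1)// ltW.
Qed.

(** Each property holds pointwise on [E] and is integrated; continuity passes to the integral by
    monotone convergence. *)
Lemma submodular_capacity_risk :
  submodular_capacity (fun A => \int[nu]_(x in E) risk A x).
Proof.
split=> [A mA|A B mA mB AB|A B mA mB|U mU ndU].
- by apply: Rintegral_ge0 => x Ex; have /andP[] := risk01 Ex mA.
- apply: le_Rintegral => // [||x Ex]; try exact: integrable_risk.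
  exact: le_risk.
- have mI := measurableI _ _ mA mB; have mU := measurableU _ _ mA mB.
  rewrite -!RintegralD//; try exact: integrable_risk.
  have intD B1 B2 : measurable B1 -> measurable B2 ->
      nu.-integrable E (EFin \o (fun x => risk B1 x + risk B2 x)).
    move=> mB1 mB2.
    exact: (integrableD mE (integrable_risk mB1) (integrable_risk mB2)).
  apply: le_Rintegral => // [||x Ex]; [exact: intD|exact: intD|].
  exact: risk_submodular.
- have mV : measurable (\bigcup_n U n) by exact: bigcup_measurable.
  apply: fine_cvg; rewrite fineK; last first.
    by apply: integrable_fin_num => //; exact: integrable_risk.
  rewrite (_ : integral _ _ _ =
      \int[nu]_(x in E) limn (fun n => (risk (U n) x)%:E))%E.
    apply: cvg_monotone_convergence => //.
    + by move=> n; apply/measurable_EFinP; exact: measurable_risk.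
    + by move=> n x Ex; rewrite lee_fin; have /andP[] := risk01 Ex (mU n).
    + move=> x Ex a b ab; rewrite lee_fin; apply: le_risk => //.
      exact/subsetPset/ndU.
  apply: eq_integral => x /set_mem Ex; apply/esym/cvg_lim => //.
  by apply: cvg_EFin; [exact: nearW|exact: risk_cvg].
Qed.

Lemma Rintegral_risk A : nu (~` E) = 0%E -> measurable A ->
  (nu A + \int[nu]_(x in ~` A) (Psi (fine (m x A)))%:E)%E =
    (\int[nu]_(x in E) risk A x)%:E.
Proof.
move=> E0 mA; have mCA := measurableC mA; have mCE := measurableC mE.
rewrite fineK; last first.
  by apply: integrable_fin_num => //; exact: integrable_risk.
rewrite [RHS]integral_mkcond.
(* Extended by 0 outside [E], the risk is measurable on the whole space, so its integral can be
   split over [A] and its complement. Each piece is then matched with the original term off the null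
   set. *)
pose h x := (EFin \o risk A) \_ E x.
have mh : measurable_fun setT h.
  apply/(measurable_restrictT _ mE)/measurable_EFinP; exact: measurable_risk.
have h0 x : (0 <= h x)%E.
  by apply: erestrict_ge0 => y Ey; rewrite lee_fin; have /andP[] := risk01 Ey mA.
rewrite -[in RHS](setUv A) [RHS]ge0_integral_setU//; last 2 first.
- by rewrite setUv; exact: mh.
- exact/disj_setPCl.
congr (_ + _)%E.
- rewrite -[LHS]mul1e -integral_cst//; apply: (eq_integral_null_set mCE E0).
  by move=> x Ax /contrapT Ex; rewrite patchE mem_set//= /risk mem_set.
- apply: (eq_integral_null_set mCE E0) => x Ax /contrapT Ex.
  by rewrite patchE mem_set//= /risk memNset.
Qed.

End risk_capacity.

(** * Existence of a minimizer of the probabilistic risk *)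

Theorem theorem1 (R : realType) (d : measure_display) (X : measurableType d)
    (mu : probability (X * bool)%type R)
    (m : X -> set X -> \bar R)
    (m_prob : {ae measure_add (label_measure mu false) (label_measure mu true),
                 forall x, is_probability (m x)})
    (m_meas : forall B, measurable B -> measurable_fun [set: X] (m ^~ B))
    (Psi : R -> R)
    (Psi01 : forall t, t \in `[0, 1] -> Psi t \in `[0, 1])
    (Psi_concave : convex_function (`[0, 1]%classic : set R)
                     (fun t => - Psi t))
    (Psi_nd : {in `[0, 1] &, {homo Psi : s t / s <= t}}) :
  exists A, measurable A /\
    ProbR mu m Psi A = ereal_inf [set ProbR mu m Psi B | B in measurable].
Proof.
have [N [mN /eqP N0 N_bad]] := m_prob.
have mE := measurableC mN.
have mE_prob x : (~` N) x -> is_probability (m x).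
  by move=> Nx; apply: contrapT => /N_bad.
(* A sum of nonnegative terms vanishes only if both do, so [N] is null for each label measure and
   its complement can serve as [E] for both. *)
move: N0; rewrite measure_addE padde_eq0 ?measure_ge0// => /andP[/eqP N0 /eqP N1].
pose rho i : {measure set X -> \bar R} := label_measure mu i.
have rho_fin i : (rho i setT < +oo)%E.
  apply: (@le_lt_trans _ _ 1%E); last exact: ltry.
  by apply: (@probability_le1 _ _ _ mu); exact: measurableX.
pose G i A := \int[rho i]_(x in ~` N) risk m Psi A x.
have GP i : submodular_capacity (G i) by exact: (submodular_capacity_risk mE).
have ProbRE A : measurable A -> ProbR mu m Psi A = (G false A + G true (~` A))%:E.
  move=> mA; have mCA := measurableC mA.
  have E0 : rho false (~` ~` N) = 0%E by rewrite setCK.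
  have E1 : rho true (~` ~` N) = 0%E by rewrite setCK.
  rewrite EFinD -(Rintegral_risk mE mE_prob m_meas Psi01 Psi_nd (rho_fin false) E0 mA).
  rewrite -(Rintegral_risk mE mE_prob m_meas Psi01 Psi_nd (rho_fin true) E1 mCA).
  by rewrite setCK addeACA addeA.
have [A mA Amin] := submodular_capacity_minimizer (GP false) (GP true).
exists A; split=> //; apply/eqP; rewrite eq_le; apply/andP; split.
  by apply: le_ereal_inf_tmp => _ [B mB <-]; rewrite !ProbRE// lee_fin Amin.
by apply: ereal_inf_lbound; exists A.
Qed.
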